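(* There exist two finite connected graphs $G$ and $G'$ (without loops or multiple edges) such that $T_G(x,y) = T_{G'}(x,y)$ and $Z_G(t,u) = Z_{G'}(t,u)$, but $\operatorname{Jac}(G) \not\cong \operatorname{Jac}(G')$ as abelian groups.
   Context: All graphs are finite, connected, without loops or multiple edges. $T_G(x,y)$ denotes the Tutte polynomial of $G$. For a graph $G$ with vertices $v_1,\dots,v_n$, a divisor is a formal sum $D=\sum a_i v_i$ with $a_i\in\mathbb{Z}$, of degree $\deg D=\sum a_i$; it is effective if all $a_i\ge 0$. The combinatorial Laplacian $\Delta(G)$ is the degree matrix minus the adjacency matrix; $\operatorname{Pic}(G)$ is the cokernel of $\Delta(G):\mathbb{Z}^n\to\mathbb{Z}^n$ (divisors modulo the image of the Laplacian; two divisors are linearly equivalent if they have the same class), and $\operatorname{Jac}(G)$ is the subgroup of $\operatorname{Pic}(G)$ of classes of degree $0$. The Baker–Norine rank $r(D)$ is $-1$ if $D$ is not linearly equivalent to an effective divisor, and otherwise the largest integer $r\ge 0$ such that for every effective divisor $E$ of degree $r$, $D-E$ is linearly equivalent to an effective divisor; it depends only on the class $[D]$. Set $h(D)=r(D)+1$. Lorenzini's two-variable zeta function is $Z_G(t,u)=\sum_{[D]\in\operatorname{Pic}(G)} \frac{u^{h(D)}-1}{u-1}\, t^{\deg D}$ (a rational function in $t,u$). *)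

(* Defs.v *)
From HB Require Import structures.
From mathcomp Require Import all_boot all_order all_algebra.
From mathcomp Require Import boolp classical_sets cardinality fsbigop.

Set Implicit Arguments.
Unset Strict Implicit.
Unset Printing Implicit Defensive.

Import Order.TTheory GRing.Theory Num.Theory.
Local Open Scope ring_scope.
Local Open Scope quotient_scope.

(* Finite graphs without loops or multiple edges, on vertices v_0, .., v_(n-1). *)
Record graph := Graph {
  order : nat;
  adj : rel 'I_order;
  adj_sym : symmetric adj;
  adj_irr : irreflexive adj
}.

(* The graph with no vertices is not connected. *)
Definition connected (G : graph) : Prop :=
  (0 < order G)%N /\ forall u v : 'I_(order G), connect (@adj G) u v.

Definition edges (G : graph) : {set {set 'I_(order G)}} :=
  [set e : {set 'I_(order G)} |
    [exists u, exists v, adj u v && (e == [set u; v])]].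

(* Rank of an edge set A: number of vertices minus number of connected
   components of the spanning subgraph with edge set A. *)
Definition edge_rank (G : graph) (A : {set {set 'I_(order G)}}) : nat :=
  (order G - n_comp [rel u v | [set u; v] \in A] 'I_(order G))%N.

(* T_G(x, y) in Z[x][y], by the corank-nullity expansion over spanning
   subgraphs; x is the inner variable and y the outer one.  The natural number
   subtractions do not truncate: edge_rank A <= edge_rank (edges G), #|A|. *)
Definition tutte (G : graph) : {poly {poly int}} :=
  \sum_(A in powerset (edges G))
     (('X - 1)%:P ^+ (edge_rank (edges G) - edge_rank A)
      * ('X - 1) ^+ (#|A| - edge_rank A)).

Notation divisor G := 'cV[int]_(order G).

Definition deg (G : graph) (D : divisor G) : int := \sum_v D v 0.

Definition effective (G : graph) (D : divisor G) : Prop := forall v, 0 <= D v 0.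

Definition laplacian (G : graph) : 'M[int]_(order G) :=
  diag_mx (\row_v (#|[set w | adj v w]|)%:R) - \matrix_(v, w) (adj v w)%:R.

Definition principal (G : graph) : {pred divisor G} :=
  fun D => `[< exists f : divisor G, D = laplacian G *m f >].

Lemma principalP (G : graph) (D : divisor G) :
  reflect (exists f : divisor G, D = laplacian G *m f) (D \in @principal G).
Proof. exact: asboolP. Qed.

Lemma principal_zmod_closed (G : graph) : zmod_closed (@principal G).
Proof.
split=> [|_ _ /principalP[f ->] /principalP[g ->]]; apply/principalP.
  by exists 0; rewrite mulmx0.
by exists (f - g); rewrite mulmxBr.
Qed.

HB.instance Definition _ (G : graph) :=
  GRing.isZmodClosed.Build (divisor G) (@principal G) (@principal_zmod_closed G).

Notation Pic G := (@Quotient.quot (divisor G) (@principal G)).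

Definition lin_equiv (G : graph) (D E : divisor G) : Prop :=
  D - E \in @principal G.

Lemma lin_equivP (G : graph) (D E : divisor G) :
  lin_equiv D E <-> \pi_(Pic G) D = \pi_(Pic G) E.
Proof.
rewrite /lin_equiv Quotient.idealrBE.
by split=> /eqP.
Qed.

Lemma degB (G : graph) (D E : divisor G) : deg (D - E) = deg D - deg E.
Proof. by rewrite /deg -sumrB; apply: eq_bigr => v _; rewrite !mxE. Qed.

Lemma deg_laplacian (G : graph) (f : divisor G) : deg (laplacian G *m f) = 0.
Proof.
rewrite /deg; under eq_bigr do rewrite mxE.
rewrite exchange_big big1 //= => w _; rewrite -mulr_suml.
suff -> : \sum_v laplacian G v w = 0 by rewrite mul0r.
under eq_bigr do rewrite !mxE.
rewrite sumrB (bigD1 w) //= eqxx mulr1n big1 => [|v /negPf-> //].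
rewrite addr0 -sum1dep_card natr_sum big_mkcond /=.
under [X in _ - X]eq_bigr do rewrite adj_sym.
by apply/eqP; rewrite subr_eq0; apply/eqP/eq_bigr => v _; case: (adj w v).
Qed.

Lemma deg_lin_equiv (G : graph) (D E : divisor G) :
  lin_equiv D E -> deg D = deg E.
Proof.
by case/principalP=> f DE; apply/eqP; rewrite -subr_eq0 -degB DE deg_laplacian.
Qed.

Definition pic_deg (G : graph) (c : Pic G) : int := deg (repr c).

Lemma lin_equiv_repr (G : graph) (D : divisor G) :
  lin_equiv (repr (\pi_(Pic G) D)) D.
Proof. by apply/lin_equivP; rewrite reprK. Qed.

Lemma pic_deg_pi (G : graph) (D : divisor G) : pic_deg (\pi_(Pic G) D) = deg D.
Proof. exact/deg_lin_equiv/lin_equiv_repr. Qed.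

Definition pic0 (G : graph) : {pred Pic G} := fun c => pic_deg c == 0.

Lemma pic0_zmod_closed (G : graph) : zmod_closed (@pic0 G).
Proof.
rewrite /pic0; split=> [|c d]; rewrite !unfold_in.
  rewrite -(@raddf0 _ _ \pi_(Pic G)) pic_deg_pi /deg big1 // => v _.
  by rewrite mxE.
rewrite -[c]reprK -[d]reprK -(@raddfB _ _ \pi_(Pic G)) !pic_deg_pi degB.
by move=> /eqP-> /eqP->.
Qed.

HB.instance Definition _ (G : graph) :=
  GRing.isZmodClosed.Build (Pic G) (@pic0 G) (@pic0_zmod_closed G).

Definition Jac (G : graph) := {c : Pic G | c \in @pic0 G}.
HB.instance Definition _ (G : graph) := SubChoice.on (Jac G).
HB.instance Definition _ (G : graph) :=
  [SubChoice_isSubZmodule of Jac G by <:].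

Definition group_iso (A B : zmodType) : Prop :=
  exists f : {additive A -> B}, bijective f.

(* D is linearly equivalent to an effective divisor. *)
Definition winnable (G : graph) (D : divisor G) : Prop :=
  exists2 E : divisor G, effective E & lin_equiv D E.

Definition rank_geq (G : graph) (D : divisor G) (r : nat) : Prop :=
  forall E : divisor G, effective E -> deg E = r%:Z -> winnable (D - E).

(* Baker--Norine rank; xget returns the largest r, which exists by rank_ex. *)
Definition bn_rank (G : graph) (D : divisor G) : int :=
  if `[< winnable D >] then
    (xget 0%N [set r | rank_geq D r /\
                       forall s, rank_geq D s -> (s <= r)%N]%classic)%:Z
  else -1.

Lemma degD (G : graph) (D E : divisor G) : deg (D + E) = deg D + deg E.
Proof. by rewrite /deg -big_split; apply: eq_bigr => v _; rewrite !mxE. Qed.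

Lemma deg_effective (G : graph) (D : divisor G) : effective D -> 0 <= deg D.
Proof. by move=> D_ge0; apply: sumr_ge0. Qed.

Lemma deg_winnable (G : graph) (D : divisor G) : winnable D -> 0 <= deg D.
Proof. by case=> E /deg_effective E_ge0 /deg_lin_equiv ->. Qed.

Lemma rank_geq0 (G : graph) (D : divisor G) : winnable D -> rank_geq D 0.
Proof.
move=> wD E E_ge0 degE; suff -> : E = 0 by rewrite subr0.
apply/matrixP=> v j; rewrite ord1 mxE.
by apply: (psumr_eq0P _ degE) => // w _; apply: E_ge0.
Qed.

Lemma rank_geq_bound (G : graph) (D : divisor G) (r : nat) :
  (0 < order G)%N -> rank_geq D r -> r%:Z <= deg D.
Proof.
move=> n_gt0 rDr; pose v0 := Ordinal n_gt0.
pose E : divisor G := \col_v (if v == v0 then r%:Z else 0).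
have degE : deg E = r%:Z.
  rewrite /deg (bigD1 v0) //= mxE eqxx big1 ?addr0 // => v /negPf v_neq.
  by rewrite mxE v_neq.
have E_ge0 : effective E by move=> v; rewrite mxE; case: ifP.
by have /deg_winnable := rDr E E_ge0 degE; rewrite degB degE subr_ge0.
Qed.

Lemma rank_ex (G : graph) (D : divisor G) :
  (0 < order G)%N -> winnable D ->
  exists2 r : nat, rank_geq D r & forall s, rank_geq D s -> (s <= r)%N.
Proof.
move=> n_gt0 wD.
have exP : exists r, `[< rank_geq D r >] by exists 0%N; apply/asboolP/rank_geq0.
have ubP r : `[< rank_geq D r >] -> (r <= `|deg D|)%N.
  move=> /asboolP /(rank_geq_bound n_gt0).
  by rewrite -lez_nat gez0_abs ?deg_winnable.
case: (ex_maxnP exP ubP) => r /asboolP rDr maxr.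
by exists r => // s /asboolP; apply: maxr.
Qed.

Lemma bn_rankP (G : graph) (D : divisor G) (r : nat) :
  (0 < order G)%N ->
  bn_rank D = r%:Z <->
  [/\ winnable D, rank_geq D r & forall s, rank_geq D s -> (s <= r)%N].
Proof.
move=> n_gt0; rewrite /bn_rank; case: asboolP => [wD|nwD]; last first.
  by split=> // -[].
have [r0 r0D r0max] := rank_ex n_gt0 wD.
case: xgetP => [x _ /= [xD xmax]|/(_ r0)]; last by case; split.
split=> [[<-]|[_ rD rmax]]; first by [].
by congr Posz; apply/eqP; rewrite eqn_leq xmax ?rmax.
Qed.

Lemma bn_rankN1 (G : graph) (D : divisor G) : bn_rank D = -1 <-> ~ winnable D.
Proof. by rewrite /bn_rank; case: asboolP. Qed.

Lemma winnable_lin_equiv (G : graph) (D D' : divisor G) :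
  lin_equiv D D' -> winnable D <-> winnable D'.
Proof.
move=> /lin_equivP eqD; rewrite /winnable.
by split=> -[E E_ge0 /lin_equivP eqE]; exists E => //;
  apply/lin_equivP; rewrite -eqE ?eqD.
Qed.

Lemma bn_rank_lin_equiv (G : graph) (D D' : divisor G) :
  lin_equiv D D' -> bn_rank D = bn_rank D'.
Proof.
move=> eqD.
have eqDE E : winnable (D - E) <-> winnable (D' - E).
  by apply: winnable_lin_equiv; rewrite /lin_equiv opprB addrA subrK.
have eqr r : rank_geq D r <-> rank_geq D' r.
  by split=> rD E E_ge0 degE; apply/eqDE/rD.
rewrite /bn_rank (propext (winnable_lin_equiv eqD)).
by have -> : rank_geq D = rank_geq D' by apply/funext => r; apply/propext.
Qed.

(* h = r + 1, a natural number since r >= -1. *)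
Definition pic_h (G : graph) (c : Pic G) : nat := absz (bn_rank (repr c) + 1).

Lemma pic_h_pi (G : graph) (D : divisor G) :
  (pic_h (\pi_(Pic G) D))%:Z = bn_rank D + 1.
Proof.
rewrite /pic_h (bn_rank_lin_equiv (lin_equiv_repr D)) gez0_abs //.
by rewrite /bn_rank; case: asboolP.
Qed.

Definition zeta_summand (h : nat) : {poly int} := ('X^h - 1) %/ ('X - 1).

(* Lorenzini's zeta function as a formal series in t over Z[u]: zeta G d is
   the coefficient of t^d.  The quotient is exact (zeta_summandE) and each sum
   has finite support (zeta_finite). *)
Definition zeta (G : graph) (d : int) : {poly int} :=
  \sum_(c \in [set c : Pic G | pic_deg c = d]%classic)
     zeta_summand (pic_h c).

Lemma zeta_summandE (h : nat) :
  zeta_summand h = \sum_(i < h) 'X^i.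
Proof.
rewrite /zeta_summand subrX1 mulrC Pdiv.IdomainMonic.mulpK //.
exact: monicXsubC.
Qed.

Lemma zeta_finite (G : graph) (d : int) :
  finite_set [set c : Pic G | pic_deg c = d /\
                            zeta_summand (pic_h c) <> 0]%classic.
Proof.
pose F (g : {ffun 'I_(order G) -> 'I_`|d|.+1}) : Pic G :=
  \pi_(Pic G) (\col_v (g v)%:Z).
apply: sub_finite_set (finite_image F (@finite_finset _ setT)).
move=> c /= [degc h_neq0].
have : winnable (repr c).
  apply: contrapT => /bn_rankN1 rN1; apply: h_neq0.
  by rewrite /pic_h rN1 zeta_summandE big_ord0.
case=> E E_ge0 eqE.
have degE : deg E = d by rewrite -(deg_lin_equiv eqE).
have E_le v : (absz (E v ord0) < `|d|.+1)%N.
  rewrite ltnS -lez_nat !gez0_abs ?E_ge0 // -?degE ?deg_effective //.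
  by rewrite /deg (bigD1 v) //= lerDl sumr_ge0.
exists [ffun v => Ordinal (E_le v)] => //.
rewrite /F -[c]reprK; apply/esym; rewrite (iffLR (lin_equivP _ _) eqE).
congr \pi; apply/matrixP => v j; rewrite ord1 mxE ffunE /= gez0_abs //.
Qed.

(* Main.v *)
(* The two graphs were found by computer search: both have eight vertices,
   eleven edges and 125 spanning trees, but the Jacobian is Z/125 for one and
   Z/5 x Z/25 for the other, so that multiplication by 25 tells them apart.

   The Tutte polynomial depends only on the numbers of edge subsets of each
   size and rank.

   Given an isomorphism psi from the degree 0 part of Pic G to J, extended to
   all divisors, h(D) is a function H_d of d = deg D and x = psi D: H_0 is the
   indicator of 0, and since r(D) is at least k + 1 exactly when every r(D - v)
   is at least k, H_(d+1)(x) is 0 if all H_d(x - psi v) vanish, and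
   1 + min_v H_d(x - psi v) otherwise.  Once H_d is a nonzero constant c, the
   functions H_(d+e) are the constants c + e, so finitely many tables determine
   the zeta function, and Riemann--Roch is not needed. *)

From HB Require Import structures.
From mathcomp Require Import all_boot all_order all_algebra.
From mathcomp Require Import boolp classical_sets cardinality fsbigop.
Require Import Defs.

Set Implicit Arguments.
Unset Strict Implicit.
Unset Printing Implicit Defensive.

Import Order.TTheory GRing.Theory Num.Theory.

(** * Corank-nullity expansion of the Tutte polynomial *)

(** The class of [a] is absorbed into that of [b]: [f'] is constant along each step of [r'], and
    conversely a vertex labelled [f a] reaches [a], crosses to [b], and so meets every vertex
    labelled [f b]. *)
Lemma connect_add_edge (T : finType) (L : eqType) (r r' : rel T) (a b : T)
    (f : T -> L) :
    connect r =2 [rel u v | f u == f v] ->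
    r' =2 [rel u v | r u v || ((u == a) && (v == b) || (u == b) && (v == a))] ->
  let f' u := if f u == f a then f b else f u in
  connect r' =2 [rel u v | f' u == f' v].
Proof.
move=> rE r'E f' u v /=.
have rr' : subrel (connect r) (connect r').
  by apply: connect_sub => x y rxy; rewrite connect1 // r'E /= rxy.
have ab : connect r' a b by rewrite connect1 // r'E /= !eqxx orbT.
have ba : connect r' b a by rewrite connect1 // r'E /= !eqxx !orbT.
apply/idP/idP.
  case/connectP=> p; elim: p u => [|w p IHp] u /=; first by move=> _ ->.
  rewrite r'E /= => /andP[ruw wp] vE; rewrite -(eqP (IHp _ wp vE)) /f'.
  case/orP: ruw => [/(@connect1 _ r)|/orP[]/andP[/eqP-> /eqP->]].
  - by rewrite rE /= => /eqP->.
  - by rewrite eqxx; case: ifP => [/eqP->|].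
  - by rewrite eqxx; case: ifP => [/eqP->|].
have crE x y : f x == f y -> connect r' x y.
  by move=> xy; apply: rr'; rewrite rE.
rewrite /f'; case: ifP => [/crE ua|_]; case: ifP => [va|_].
- by move=> _; rewrite (connect_trans ua) // crE // eq_sym.
- by move=> /crE bv; rewrite (connect_trans ua) // (connect_trans ab).
- move=> /crE ub; rewrite (connect_trans ub) // (connect_trans ba) //.
  by rewrite crE // eq_sym.
- exact: crE.
Qed.

(** Each class has one root, [f] is injective on roots, and every label is the label of a root. *)
Lemma n_comp_labels (T : finType) (L : eqType) (r : rel T) (f : T -> L) :
  connect r =2 [rel u v | f u == f v] ->
  n_comp r T = size (undup [seq f u | u : T]).
Proof.
move=> rE; have symr : connect_sym r by move=> x y; rewrite !rE /= eq_sym.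
rewrite /n_comp_mem cardE -(size_map f); apply/perm_size/uniq_perm.
- rewrite map_inj_in_uniq ?enum_uniq // => u v.
  rewrite !mem_enum !inE !andbT => /eqP ru /eqP rv fuv.
  by rewrite -ru -rv; apply/(fingraph.rootP symr); rewrite rE /= fuv.
- exact: undup_uniq.
move=> x; rewrite mem_undup; apply/mapP/mapP => -[u _ ->]; last first.
  exists (fingraph.root r u); first by rewrite mem_enum !inE andbT roots_root.
  by apply/eqP; have := connect_root r u; rewrite rE.
by exists u; rewrite ?mem_enum.
Qed.

(** * Graphs given by edge lists, and their components *)

Definition adjn n (es : seq (nat * nat)) : rel 'I_n :=
  fun u v => ((val u, val v) \in es) || ((val v, val u) \in es).

Lemma adjn_sym n es : symmetric (@adjn n es).
Proof. by move=> u v; rewrite /adjn orbC. Qed.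

Lemma adjn_cons n a b es :
  @adjn n ((a, b) :: es) =2
  [rel u v | adjn es u v || ((u == a :> nat) && (v == b :> nat) ||
                             (u == b :> nat) && (v == a :> nat))].
Proof.
move=> u v; rewrite /adjn /= !in_cons !xpair_eqE.
by rewrite [(v == a :> nat) && _]andbC -orbA [RHS]orbC -!orbA; do !bool_congr.
Qed.

(** Convertible to [edges] of [list_graph], but defined for any list, so that sublists can stand for
    edge subsets. *)
Definition edge_set n es : {set {set 'I_n}} :=
  [set e | [exists u, exists v, adjn es u v && (e == [set u; v])]].

Lemma set2_eq (T : finType) (a b c d : T) :
  [set a; b] = [set c; d] -> (a = c /\ b = d) \/ (a = d /\ b = c).
Proof.
move=> eqs.
have /set2P[ac|ad] : a \in [set c; d] by rewrite -eqs set21.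
- subst c; have /set2P[ba|bd] : b \in [set a; d] by rewrite -eqs set22.
    subst b; have /set2P[->|->] : d \in [set a; a] by rewrite eqs set22.
    + by left.
    + by left.
  by left.
subst d; have /set2P[bc|ba] : b \in [set c; a] by rewrite -eqs set22.
  by right.
subst b; have /set2P[->|->] : c \in [set a; a] by rewrite eqs set21.
- by left.
- by left.
Qed.

Lemma in_edge_set n es (u v : 'I_n) :
  ([set u; v] \in edge_set n es) = adjn es u v.
Proof.
rewrite inE; apply/existsP/idP => [[u' /existsP[v' /andP[uv' /eqP]]]|uv].
  by case/set2_eq=> -[-> ->] //; rewrite adjn_sym.
by exists u; apply/existsP; exists v; rewrite uv eqxx.
Qed.

(** Increasing pairs exclude loops and give each edge a single representation. *)
Definition lt_edges n := all (fun x : nat * nat => x.1 < x.2 < n).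

Definition merge_labels (x : nat * nat) (lab : seq nat) : seq nat :=
  [seq if c == nth 0 lab x.1 then nth 0 lab x.2 else c | c <- lab].

Definition labels n : seq (nat * nat) -> seq nat :=
  foldr merge_labels (iota 0 n).

Lemma size_labels n es : size (labels n es) = n.
Proof. by elim: es => [|x es IHes]; rewrite ?size_iota //= size_map. Qed.

(** Without edges the labels [iota 0 n] are distinct; each further edge is an instance of
    [connect_add_edge], with [merge_labels] computing its [f']. *)
Lemma connect_labels n es : lt_edges n es ->
  connect (@adjn n es) =2
  [rel u v : 'I_n | nth 0 (labels n es) u == nth 0 (labels n es) v].
Proof.
elim: es => [_|[a b] es IHes /= /andP[/andP[ab bn] /IHes{}IHes]] u v /=.
  rewrite !nth_iota // !add0n; apply/connectP/eqP => [[[|w p] //= _ ->]|] //.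
  by move=> /val_inj uv; exists [::].
have an := ltn_trans ab bn.
rewrite (connect_add_edge (a := Ordinal an) (b := Ordinal bn) IHes) /=.
  by rewrite !(nth_map 0) ?size_labels.
by move=> x y; rewrite adjn_cons.
Qed.

Definition rank_labels n es := n - size (undup (labels n es)).

Lemma n_comp_adjn n es : lt_edges n es ->
  n_comp (@adjn n es) 'I_n = size (undup (labels n es)).
Proof.
move=> /connect_labels/n_comp_labels ->; congr (size (undup _)).
apply: (@eq_from_nth _ 0).
  by rewrite size_map -cardE card_ord size_labels.
move=> i; rewrite size_map -cardE card_ord => lt_in.
by rewrite (nth_map (Ordinal lt_in)) -?cardE ?card_ord // nth_enum_ord.
Qed.

Lemma edge_set_cons n a b es (an : a < n) (bn : b < n) :
  edge_set n ((a, b) :: es) = [set Ordinal an; Ordinal bn] |: edge_set n es.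
Proof.
apply/setP=> e; rewrite in_setU1.
apply/idP/orP.
  rewrite inE => /existsP[u /existsP[v /andP[]]]; rewrite adjn_cons /=.
  case/or3P => [uv /eqP-> | /andP[/eqP ua /eqP vb] /eqP-> |
                /andP[/eqP ub /eqP va] /eqP->].
  - by right; rewrite in_edge_set.
  - by left; apply/eqP; congr [set _; _]; apply: val_inj.
  - by left; apply/eqP; rewrite finset.setUC; congr [set _; _]; apply: val_inj.
case=> [/eqP->|].
  by rewrite in_edge_set adjn_cons /= !eqxx orbT.
rewrite !inE => /existsP[u /existsP[v /andP[uv /eqP->]]].
apply/existsP; exists u; apply/existsP; exists v.
by rewrite adjn_cons /= uv eqxx.
Qed.

(** The reversed pair [(b, a)] is absent as well, because the pairs in [es] increase. *)
Lemma notin_edge_set n a b es (an : a < n) (bn : b < n) :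
    a < b -> (a, b) \notin es -> lt_edges n es ->
  [set Ordinal an; Ordinal bn] \notin edge_set n es.
Proof.
move=> ab abNes /allP es_lt; rewrite in_edge_set /adjn /= (negPf abNes) /=.
by apply/negP => /es_lt /=; rewrite ltnNge (ltnW ab).
Qed.

Lemma card_edge_set n es : lt_edges n es -> uniq es ->
  #|edge_set n es| = size es.
Proof.
elim: es => [_ _|[a b] es IHes]; last first.
  move=> /= /andP[/andP[ab bn] es_lt] /andP[abNes es_uniq].
  rewrite (edge_set_cons _ (ltn_trans ab bn) bn) cardsU1 notin_edge_set //.
  by rewrite IHes.
apply/eqP; rewrite cards_eq0; apply/eqP/setP => e; rewrite !inE.
by apply/existsP => -[u /existsP[v]].
Qed.

(** * Sums over edge subsets as sums over sublists *)

Fixpoint sublists (T : Type) (s : seq T) : seq (seq T) :=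
  if s is x :: s' then sublists s' ++ [seq x :: t | t <- sublists s']
  else [:: [::]].

Lemma sublists_subseq (T : eqType) (s t : seq T) :
  t \in sublists s -> subseq t s.
Proof.
elim: s t => [|x s IHs] t /=; first by rewrite inE => /eqP->.
rewrite mem_cat => /orP[/IHs ts|/mapP[t' /IHs t's ->]].
  exact: subseq_trans ts (subseq_cons _ _).
by rewrite /= eqxx.
Qed.

(** Subsets are split by membership of [a]; those containing [a] are [a |: A] for a unique subset
    [A] of [S]. *)
Lemma big_powersetU1 (V : nmodType) (T : finType) (a : T) (S : {set T})
    (F : {set T} -> V) : a \notin S ->
  (\sum_(A in powerset (a |: S)) F A =
   \sum_(A in powerset S) F A + \sum_(A in powerset S) F (a |: A))%R.
Proof.
move=> aNS; rewrite (bigID (fun A : {set T} => a \notin A)) /=; congr (_ + _)%R.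
  apply: eq_bigl => A; rewrite !powersetE.
  apply/andP/idP => [[/fintype.subsetP AaS aA]|AS].
    apply/fintype.subsetP => x xA; have := AaS x xA.
    by rewrite in_setU1 => /predU1P[xa|//]; rewrite -xa xA in aA.
  split; last by apply: contra aNS; apply: (fintype.subsetP AS).
  exact: fintype.subset_trans AS (subsetU1 _ _).
rewrite (reindex_onto (fun A => a |: A) (fun A => A :\ a)) /=; last first.
  by move=> A /andP[_]; rewrite negbK => /finset.setD1K.
apply: eq_bigl => A; rewrite !powersetE setU11 /= andbT.
apply/andP/idP => [[aAS /eqP AE]|AS].
  rewrite -AE; apply/fintype.subsetP => x /finset.setD1P[xa xA].
  by have := fintype.subsetP aAS _ xA; rewrite in_setU1 (negPf xa).
rewrite finset.setUS //; split=> //; apply/eqP/finset.setU1K.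
by apply: contra aNS; apply: (fintype.subsetP AS).
Qed.

(** By induction: a new edge splits the powerset in the same way as [sublists] splits. *)
Lemma big_powerset_edge_set (V : nmodType) n es
    (F : {set {set 'I_n}} -> V) :
    lt_edges n es -> uniq es ->
  (\sum_(A in powerset (edge_set n es)) F A =
   \sum_(s <- sublists es) F (edge_set n s))%R.
Proof.
elim: es F => [|[a b] es IHes] F /=.
  rewrite big_seq1 => _ _.
  have -> : edge_set n [::] = finset.set0.
    by apply/setP => e; rewrite !inE; apply/existsP => -[u /existsP[v]].
  by rewrite powerset0 big_set1.
move=> /andP[/andP[ab bn] es_lt] /andP[abNes es_uniq].
have an := ltn_trans ab bn.
rewrite (edge_set_cons _ an bn) big_powersetU1 ?notin_edge_set //.
rewrite big_cat big_map /= !IHes //; congr (_ + _)%R.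
by apply: eq_bigr => s _; rewrite edge_set_cons.
Qed.

(** Kept transparent so that [order] and [adj] reduce to [n] and [adjn es]. *)
Definition list_graph n es (es_lt : lt_edges n es) : graph.
Proof.
apply: (@Graph n (@adjn n es) (@adjn_sym n es)) => u; rewrite /adjn orbb.
by apply/negP => /(allP es_lt); rewrite /= ltnn.
Defined.

Definition rank_sizes n es :=
  [seq (rank_labels n s, size s) | s <- sublists es].

Lemma edge_rank_labels n es (es_lt : lt_edges n es) s :
  lt_edges n s ->
  @edge_rank (list_graph es_lt) (edge_set n s) = rank_labels n s.
Proof.
move=> s_lt; rewrite /edge_rank /rank_labels -(n_comp_adjn s_lt) /=.
congr (n - _).
by apply: eq_n_comp; apply: eq_connect => u v /=; rewrite in_edge_set.
Qed.

(** Sublists inherit [lt_edges] and [uniq], so the rank and cardinality of each edge subset can be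
    computed from its list. *)
Lemma tutte_list_graph n es (es_lt : lt_edges n es) : uniq es ->
  tutte (list_graph es_lt) =
  (\sum_(x <- rank_sizes n es) ('X - 1)%:P ^+ (rank_labels n es - x.1)
                            * ('X - 1) ^+ (x.2 - x.1))%R.
Proof.
move=> es_uniq; rewrite /tutte big_powerset_edge_set // big_map.
rewrite big_seq [RHS]big_seq; apply: eq_bigr => s /sublists_subseq s_es.
have s_lt : lt_edges n s by exact/allP/(sub_in1 (mem_subseq s_es))/allP.
have s_uniq := subseq_uniq s_es es_uniq.
by rewrite !edge_rank_labels // card_edge_set.
Qed.

Lemma tutte_list_graph_eq n es es' (es_lt : lt_edges n es)
    (es'_lt : lt_edges n es') :
    uniq es -> uniq es' -> rank_labels n es = rank_labels n es' ->
    perm_eq (rank_sizes n es) (rank_sizes n es') ->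
  tutte (list_graph es_lt) = tutte (list_graph es'_lt).
Proof.
move=> es_uniq es'_uniq rankE eqs.
by rewrite !tutte_list_graph // rankE (perm_big _ eqs).
Qed.

Lemma connected_list_graph n es (es_lt : lt_edges n es) c :
  0 < n -> labels n es = nseq n c -> connected (list_graph es_lt).
Proof.
move=> n_gt0 labE; split=> // u v.
by rewrite [connect _ _ _](connect_labels es_lt) /= labE !nth_nseq !ltn_ord.
Qed.

(** Reduces a comparison of long multisets to the evaluation of two sorted lists. *)
Lemma perm_of_sort (T : eqType) (r : rel T) (s t : seq T) :
  sort r s = sort r t -> perm_eq s t.
Proof. by rewrite -(perm_sort r s) => ->; rewrite (perm_sort r). Qed.

(** * Chip-firing rank *)

Local Open Scope ring_scope.
Local Open Scope quotient_scope.

Definition point (G : graph) (v : 'I_(order G)) : divisor G := delta_mx v 0.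

Lemma degMn (G : graph) (D : divisor G) m : deg (D *+ m) = deg D *+ m.
Proof. by rewrite /deg -sumrMnl; apply: eq_bigr => v _; rewrite mulmxnE. Qed.

Section Rank.
Variable G : graph.
Implicit Types D E : divisor G.

Lemma deg_point (v : 'I_(order G)) : deg (point v) = 1.
Proof.
rewrite /deg (bigD1 v) //= mxE !eqxx big1 ?addr0 // => w /negPf wv.
by rewrite mxE wv.
Qed.

Lemma effective_point (v : 'I_(order G)) : effective (point v).
Proof. by move=> w; rewrite mxE; case: (_ && _). Qed.

Lemma effectiveD D E : effective D -> effective E -> effective (D + E).
Proof. by move=> D_ge0 E_ge0 v; rewrite mxE addr_ge0. Qed.

Lemma effective_deg0 E : effective E -> deg E = 0 -> E = 0.
Proof.
move=> E_ge0 degE; apply/matrixP => v j; rewrite ord1 mxE.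
by apply: (psumr_eq0P _ degE) => // w _; apply: E_ge0.
Qed.

Lemma effective_split E k : effective E -> deg E = k.+1%:Z ->
  exists v, effective (E - point v).
Proof.
move=> E_ge0 degE.
have [v Ev|E0] := pickP (fun v => 0 < E v ord0).
  exists v => w; rewrite !mxE andbT; case: eqP => [->|_]; last by rewrite subr0.
  by rewrite subr_ge0 -gtz0_ge1.
suff: deg E = 0 by rewrite degE.
rewrite /deg big1 // => v _; apply/eqP; rewrite eq_le E_ge0 andbT leNgt.
by rewrite E0.
Qed.

Lemma winnableD D E : winnable D -> effective E -> winnable (D + E).
Proof.
case=> F F_ge0 DF E_ge0; exists (F + E); first exact: effectiveD.
by rewrite /lin_equiv opprD addrACA subrr addr0.
Qed.

(** An effective divisor of positive degree has a chip to remove; conversely, adding a chip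
    preserves winnability. *)
Lemma winnable_split D k : deg D = k.+1%:Z ->
  winnable D <-> exists v, winnable (D - point v).
Proof.
move=> degD; split=> [[E E_ge0 DE]|[v wDv]].
  have [|v Ev] := effective_split E_ge0 (k := k).
    by rewrite -(deg_lin_equiv DE).
  exists v; exists (E - point v) => //.
  by rewrite /lin_equiv opprB addrA subrK.
by rewrite -(subrK (point v) D); apply: winnableD => //; apply: effective_point.
Qed.

(** An effective divisor of degree k + 1 is a vertex plus an effective divisor of degree k, so it
    can be subtracted in two stages. *)
Lemma rank_geq_split D k :
  rank_geq D k.+1 <-> forall v, rank_geq (D - point v) k.
Proof.
split=> [rD v E E_ge0 degE|rD E E_ge0 degE].
  rewrite -addrA -opprD; apply: rD; last by rewrite degD degE deg_point.
  exact: effectiveD (effective_point v) E_ge0.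
have [v Ev] := effective_split E_ge0 degE.
have -> : D - E = (D - point v) - (E - point v) by rewrite opprB addrA subrK.
by apply: rD => //; rewrite degB degE deg_point -addn1 PoszD addrK.
Qed.

Lemma rank_geq0E D : rank_geq D 0 <-> winnable D.
Proof.
split=> [rD|]; last exact: rank_geq0.
rewrite -[D]subr0; apply: rD => [v|]; first by rewrite mxE.
by rewrite /deg big1 // => v _; rewrite mxE.
Qed.

Hypothesis G_gt0 : (0 < order G)%N.

(** A divisor [E] of degree k is enlarged by a chip on a fixed vertex; if D - E - v is winnable, so
    is D - E. *)
Lemma rank_geq_antitone D k l : (k <= l)%N -> rank_geq D l -> rank_geq D k.
Proof.
move=> /subnKC<-; elim: (l - k)%N D => [|m IHm] D; first by rewrite addn0.
move=> rD; apply: IHm => E E_ge0 degE; pose v := Ordinal G_gt0.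
rewrite -(subrK (point v) (D - E)); apply: winnableD (effective_point v).
rewrite -addrA -opprD; apply: rD; first exact: effectiveD (effective_point v).
by rewrite degD degE deg_point addnS -addn1 PoszD.
Qed.

Definition hrank D : nat := absz (bn_rank D + 1).

(** Describes h by thresholds, the rank -1 included as h = 0; equalities of h are later proved by
    comparing all thresholds. *)
Lemma ltn_hrank D k : (k < hrank D)%N <-> rank_geq D k.
Proof.
have [wD|nwD] := pselect (winnable D); last first.
  rewrite /hrank (iffRL (bn_rankN1 D) nwD) ltn0; split=> // /rank_geq_antitone.
  by move=> /(_ 0%N isT)/rank_geq0E.
have [r rD rmax] := rank_ex G_gt0 wD.
rewrite /hrank (iffRL (bn_rankP D r G_gt0) _) // -PoszD addn1 ltnS.
by split=> [/rank_geq_antitone|]; [apply|apply: rmax].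
Qed.

Lemma hrank_deg_lt0 D : deg D < 0 -> hrank D = 0%N.
Proof.
move=> degD_lt0; apply/eqP; rewrite -leqn0 leqNgt; apply/negP.
by move=> /ltn_hrank/rank_geq0E/deg_winnable; rewrite leNgt degD_lt0.
Qed.

Lemma pic_hE (c : Pic G) : pic_h c = hrank (repr c). Proof. by []. Qed.

Lemma hrank_lin_equiv D E : lin_equiv D E -> hrank D = hrank E.
Proof. by move=> /bn_rank_lin_equiv DE; rewrite /hrank DE. Qed.

End Rank.

(** The test for a positive entry separates rank -1 from rank 0, since the minimum may be 0 in both
    cases. Starting the minimum at [head 0 s] adds no value foreign to a nonempty [s]. *)
Definition hstep (J : zmodType) (l : seq J) (h : J -> nat) (x : J) : nat :=
  let s := [seq h (x - a) | a <- l] in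
  if has (leq 1) s then (foldr minn (head 0 s) s).+1 else 0%N.

Fixpoint hfun (J : zmodType) (l : seq J) (d : nat) (x : J) : nat :=
  if d is d'.+1 then hstep l (hfun l d') x else (x == 0).

(** The threshold form of [hstep]: the [has] part mirrors [winnable_split] and the [all] part
    mirrors [rank_geq_split]. *)
Lemma ltn_hstep (J : zmodType) (l : seq J) (h : J -> nat) (x : J) k :
  (k < hstep l h x)%N =
  has (fun a => 0 < h (x - a)%R)%N l && all (fun a => k <= h (x - a)%R)%N l.
Proof.
rewrite /hstep -(has_map (fun a => h (x - a)) (leq 1)).
rewrite -(all_map (fun a => h (x - a)) (leq k)).
case: [seq _ | _ <- _] => [|m s]; first by rewrite ltn0.
case: ifP => // _; rewrite ltnS /= leq_min.
have -> : (k <= foldr minn m s)%N = (k <= m)%N && all (leq k) s.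
  by elim: s => [|i s /= IHs]; rewrite ?andbT //= leq_min IHs andbCA.
by rewrite andbA andbb.
Qed.

(* Under [is_chart psi], [(deg, psi)] identifies [Pic G] with [int * J]. *)
Definition is_chart (G : graph) (J : zmodType)
    (psi : {additive divisor G -> J}) : Prop :=
  [/\ (0 < order G)%N,
      forall D : divisor G, deg D = 0 -> (D \in @principal G) = (psi D == 0)
    & forall x, exists2 D : divisor G, deg D = 0 & psi D = x].

(** * Ranks, zeta function and torsion read through a chart *)

Section Chart.
Variables (G : graph) (J : zmodType) (psi : {additive divisor G -> J}).
Hypothesis psi_chart : is_chart psi.

Let G_gt0 : (0 < order G)%N. Proof. by case: psi_chart. Qed.

Let psi_principal (D : divisor G) :
  deg D = 0 -> (D \in @principal G) = (psi D == 0).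
Proof. by case: psi_chart => _ + _; apply. Qed.

Let psi_onto x : exists2 D : divisor G, deg D = 0 & psi D = x.
Proof. by case: psi_chart => _ _; apply. Qed.

Lemma chart_lin_equiv (D E : divisor G) : deg D = deg E ->
  lin_equiv D E <-> psi D = psi E.
Proof.
move=> degDE; rewrite /lin_equiv psi_principal ?degB ?degDE ?subrr // raddfB.
by rewrite subr_eq0; split=> /eqP.
Qed.

Lemma hrank_hfun (D : divisor G) (d : nat) : deg D = d%:Z ->
  hrank D = hfun [seq psi (point v) | v <- enum 'I_(order G)] d (psi D).
Proof.
(* Both sides are known through their thresholds [k], so these are compared, by induction on the
   degree. *)
suff eqk (d' : nat) (D' : divisor G) : deg D' = d'%:Z -> forall k,
    (k < hrank D')%N =
    (k < hfun [seq psi (point v) | v <- enum 'I_(order G)] d' (psi D'))%N.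
  move=> /eqk{}eqk; apply/eqP; rewrite eqn_leq.
  by rewrite leqNgt eqk ltnn leqNgt -eqk ltnn.
elim: d' {D d} D' => [|d IHd] D degD k.
  apply/idP/idP => [/(ltn_hrank G_gt0) rk|].
    (* The rank is at most the degree, so in degree 0 only winnability remains, and there it means
       being principal. *)
    have k0 : k = 0%N.
      by apply/eqP; rewrite -leqn0 -lez_nat -degD; apply: rank_geq_bound rk.
    rewrite k0 in rk *; case/rank_geq0E: rk => E E_ge0 DE.
    rewrite /= -(psi_principal degD).
    have -> : D = D - E.
      by rewrite (effective_deg0 E_ge0) ?subr0 // -(deg_lin_equiv DE).
    by rewrite lt0b.
  rewrite [hfun _ _ _]/= -(psi_principal degD).
  case: (boolP (D \in _)) => //= Dprinc; case: k => // _.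
  apply/(ltn_hrank G_gt0)/rank_geq0E; exists 0; first by move=> v; rewrite mxE.
  by rewrite /lin_equiv subr0.
have degDv v : deg (D - point v) = d%:Z.
  by rewrite degB degD deg_point -addn1 PoszD addrK.
have hfunE v : hfun [seq psi (point w) | w <- enum 'I_(order G)] d
    (psi D - psi (point v)) = hrank (D - point v).
  rewrite -raddfB; apply/eqP.
  by rewrite eqn_leq leqNgt -IHd // ltnn leqNgt IHd // ltnn.
rewrite [hfun _ _ _]/= ltn_hstep has_map all_map.
apply/idP/andP => [|[/hasP[v _ /=]]].
  move=> /(ltn_hrank G_gt0) rk; split.
    have [v wDv] : exists v, winnable (D - point v).
      apply/(winnable_split degD)/rank_geq0E.
      exact: rank_geq_antitone rk.
    apply/hasP; exists v; rewrite ?mem_enum //= hfunE.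
    exact/(ltn_hrank G_gt0)/rank_geq0E.
  apply/allP => v _ /=; rewrite hfunE; case: k rk => // k rk.
  exact/(ltn_hrank G_gt0)/(iffLR (rank_geq_split _ _) rk).
rewrite hfunE => /(ltn_hrank G_gt0)/rank_geq0E wDv /allP rk.
apply/(ltn_hrank G_gt0); case: k rk => [_|k rk].
  by apply/rank_geq0E/(winnable_split degD); exists v.
apply/rank_geq_split => w; apply/(ltn_hrank G_gt0).
by rewrite -hfunE; apply: rk; rewrite mem_enum.
Qed.

(** In each degree the chart identifies the classes with [J], so the sum over classes becomes a sum
    over [elems]; negative degrees give h = 0. *)
Lemma zeta_hfun (elems : seq J) (d : int) : uniq elems -> elems =i predT ->
  zeta G d = \sum_(x <- elems) zeta_summand
    (if d is Posz m then
       hfun [seq psi (point v) | v <- enum 'I_(order G)] m x else 0%N).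
Proof.
move=> elems_uniq elemsT; pose v0 := Ordinal G_gt0.
have /boolp.choice[D /all_and2[degD psiD]] x :
    exists D : divisor G, deg D = d /\ psi D = x.
  have [D D0 psiD] := psi_onto (x - psi (point v0 *~ d)).
  (* Adding [d] chips on [v0] gives degree [d]; their image was subtracted from [x] beforehand. *)
  exists (D + point v0 *~ d); rewrite raddfD psiD subrK; split=> //.
  have -> : point v0 *~ d = d *: point v0 by rewrite -scaler_int intz.
  rewrite degD D0 add0r /deg (bigD1 v0) //= !mxE eqxx mulr1 big1 ?addr0 //.
  by move=> w /negPf wv; rewrite !mxE wv mulr0.
pose c x : Pic G := \pi_(Pic G) (D x).
have degc x : pic_deg (c x) = d by rewrite pic_deg_pi.
have c_inj : injective c.
  move=> x y /lin_equivP; rewrite chart_lin_equiv ?degD //.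
  by rewrite !psiD.
rewrite /zeta (fsbigE [seq c x | x <- elems]).
- rewrite big_map; apply: eq_big => [x|x _]; first by rewrite mem_set //= degc.
  congr zeta_summand; rewrite pic_hE (hrank_lin_equiv (lin_equiv_repr _)).
  case: d degD {c degc c_inj} => m degD; last by rewrite hrank_deg_lt0 // degD.
  by rewrite (hrank_hfun (degD x)) psiD.
- by rewrite map_inj_uniq.
- by move=> _ /= /mapP[x _ ->].
(* No class is missed: a class [k] of degree [d] is listed at [psi (repr k)]. *)
move=> k /= degk /negP[]; apply/mapP; exists (psi (repr k)); rewrite ?elemsT //.
rewrite -[k in LHS]reprK; apply/lin_equivP/chart_lin_equiv; rewrite ?psiD //.
by rewrite degD.
Qed.

Lemma chart_torsion (D : divisor G) m : deg D = 0 ->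
  (\pi_(Pic G) D *+ m == 0) = (psi D *+ m == 0).
Proof.
move=> degD0; rewrite -(raddfMn psi) -psi_principal ?degMn ?degD0 ?mul0rn //.
rewrite -(raddfMn \pi_(Pic G)) -[X in _ == X](raddf0 \pi_(Pic G)).
by apply/eqP/idP => [/lin_equivP|]; first rewrite /lin_equiv subr0 //;
  move=> Dm; apply/lin_equivP; rewrite /lin_equiv subr0.
Qed.

(** Elements of [J] lift to divisors of degree 0, and classes in [Jac G] have such representatives;
    [chart_torsion] compares the two. *)
Lemma jac_exponent m :
  (forall y : Jac G, y *+ m = 0) <-> (forall x : J, x *+ m = 0).
Proof.
split=> [jac0 x|J0 y].
  have [D degD0 <-] := psi_onto x; apply/eqP; rewrite -chart_torsion //.
  have D_pic0 : \pi_(Pic G) D \in @pic0 G.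
    by rewrite unfold_in pic_deg_pi degD0.
  have := congr1 val (jac0 (exist (fun c => c \in @pic0 G) _ D_pic0 : Jac G)).
  by rewrite raddfMn /= => ->.
apply: val_inj; rewrite raddfMn /=; apply/eqP; rewrite -[val y]reprK.
by rewrite chart_torsion ?J0 //; apply/eqP/(valP y).
Qed.
End Chart.

(** * Certified charts of the Picard group *)

(** A form of the finite sum that evaluates, for use in certificates. *)
Definition sum_seq (V : zmodType) (n : nat) (F : nat -> V) : V :=
  foldr +%R 0 [seq F i | i <- iota 0 n].

Lemma sum_seqE (V : zmodType) n (F : nat -> V) : \sum_(i < n) F i = sum_seq n F.
Proof.
by rewrite /sum_seq foldrE big_map -(big_mkord xpredT) /index_iota subn0.
Qed.

Definition col_seq n (s : seq int) : 'cV[int]_n := \col_i s`_i.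

Definition lap_seq n (es : seq (nat * nat)) (s : seq int) : seq int :=
  mkseq (fun i => sum_seq n (fun j =>
    if ((i, j) \in es) || ((j, i) \in es) then s`_i - s`_j else 0)) n.

Lemma pi_laplacian (G : graph) (f : divisor G) :
  \pi_(Pic G) (laplacian G *m f) = 0.
Proof.
rewrite -(raddf0 \pi_(Pic G)); apply/lin_equivP.
by rewrite /lin_equiv subr0; apply/principalP; exists f.
Qed.

Lemma divisor_sum_point (G : graph) (D : divisor G) :
  D = \sum_v point v *~ D v 0.
Proof.
apply/matrixP => i j; rewrite ord1 summxE (bigD1 i) //= big1 ?addr0.
  by rewrite -scaler_int intz !mxE !eqxx mulr1.
by move=> w /negPf wi; rewrite -scaler_int intz !mxE eq_sym wi mulr0.
Qed.

Lemma laplacianE (G : graph) (f : divisor G) w :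
  (laplacian G *m f) w 0 = \sum_v (if adj w v then f w 0 - f v 0 else 0).
Proof.
rewrite mulmxBl mul_diag_mx !mxE -sumr_const mulr_suml big_mkcond -sumrB /=.
apply: eq_bigr => v _; rewrite !mxE inE.
by case: adj; rewrite ?mul1r ?mul0r ?subrr.
Qed.

Lemma laplacian_list_graph n es (es_lt : lt_edges n es) s :
  laplacian (list_graph es_lt) *m col_seq n s = col_seq n (lap_seq n es s).
Proof.
apply/matrixP => i j; rewrite ord1 laplacianE [RHS]mxE nth_mkseq // -sum_seqE.
by apply: eq_bigr => v _; rewrite !mxE.
Qed.

(** * Homomorphisms to and from Z/(p+1) x Z/(q+1) *)

Section Coord.
Variables (p q n : nat) (al : seq (nat * nat)).
Notation J := ('I_p.+1 * 'I_q.+1)%type.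

Definition zp (a : nat * nat) : J := (inZp a.1, inZp a.2).

Definition coord (D : 'cV[int]_n) : J :=
  \sum_(i < n) zp (nth (0, 0)%N al i) *~ D i 0.

Lemma coord_zmod_morphism : zmod_morphism coord.
Proof.
by move=> D E; rewrite -sumrB; apply: eq_bigr => i _; rewrite !mxE mulrzBr.
Qed.

HB.instance Definition _ :=
  GRing.isZmodMorphism.Build _ _ coord coord_zmod_morphism.

Definition coord_seq (s : seq int) : J :=
  sum_seq n (fun i => zp (nth (0, 0)%N al i) *~ s`_i).

Lemma coord_col_seq s : coord (col_seq n s) = coord_seq s.
Proof. by rewrite /coord_seq -sum_seqE; apply: eq_bigr => i _; rewrite mxE. Qed.

End Coord.

Lemma coord_point p q (G : graph) al (v : 'I_(order G)) :
  coord p q al (point v) = zp p q (nth (0, 0)%N al v).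
Proof.
rewrite /coord (bigD1 v) //= mxE !eqxx mulr1z big1 ?addr0 // => w /negPf wv.
by rewrite mxE wv mulr0z.
Qed.

Lemma mulrn_mod (V : zmodType) (b : V) p m :
  b *+ p = 0 -> b *+ (m %% p) = b *+ m.
Proof.
move=> bp; rewrite [in RHS](divn_eq m p) mulrnDr mulnC mulrnA bp.
by rewrite mul0rn add0r.
Qed.

Section Lift.
Variables (p q : nat) (V : zmodType) (b1 b2 : V).
Hypotheses (b1p : b1 *+ p.+1 = 0) (b2q : b2 *+ q.+1 = 0).

(** Sends the two standard generators to [b1] and [b2]. With values in [Pic G] it serves to invert
    [coord] in degree 0. *)
Definition zp_lift (x : 'I_p.+1 * 'I_q.+1) : V := b1 *+ x.1 + b2 *+ x.2.

Lemma zp_lift_zp a : zp_lift (zp p q a) = b1 *+ a.1 + b2 *+ a.2.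
Proof. by rewrite /zp_lift /= !mulrn_mod. Qed.

Lemma zp_lift_zmod_morphism : zmod_morphism zp_lift.
Proof.
(* Writing [x] as (x - y) + y leaves only a sum of residues to reduce. *)
move=> x y; apply: (addIr (zp_lift y)); rewrite subrK.
rewrite -{2}[x](subrK y); move: (x - y) => z.
by rewrite /zp_lift /= !mulrn_mod // !mulrnDr addrACA.
Qed.

Definition zp_lift_additive : {additive 'I_p.+1 * 'I_q.+1 -> V} :=
  HB.pack zp_lift
    (GRing.isZmodMorphism.Build _ _ zp_lift zp_lift_zmod_morphism).
End Lift.

(* With [a := nth (0, 0) al v], the vector [nth [::] S v] witnesses that
   v - v_0 is equivalent to [a.1 B1 + a.2 B2], and [c1], [c2] witness that B1
   and B2 are killed by the moduli, which are p + 1 and q + 1.  Missing trailing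
   entries of the lists count as 0. *)
Definition jac_cert n es p q (al : seq (nat * nat)) (S : seq (seq int))
    (B1 B2 c1 c2 : seq int) : bool :=
  [&& all (fun v => coord_seq p q n al
                      (lap_seq n es (mkseq (fun i => (i == v)%:R) n)) == 0)
        (iota 0 n),
      all (fun v => let a := nth (0, 0)%N al v in
                    lap_seq n es (nth [::] S v) ==
                    mkseq (fun i => (i == v)%:R - (i == 0)%:R
                                    - B1`_i *+ a.1 - B2`_i *+ a.2) n)
        (iota 0 n),
      lap_seq n es c1 == mkseq (fun i => B1`_i *+ p.+1) n,
      lap_seq n es c2 == mkseq (fun i => B2`_i *+ q.+1) n,
      coord_seq p q n al B1 == zp p q (1, 0)%N,
      coord_seq p q n al B2 == zp p q (0, 1)%N,
      sum_seq n (nth 0 B1) == 0 & sum_seq n (nth 0 B2) == 0].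

Section Cert.
Variables (n : nat) (es : seq (nat * nat)) (es_lt : lt_edges n.+1 es).
Variables (p q : nat) (al : seq (nat * nat)) (S : seq (seq int)).
Variables (B1 B2 c1 c2 : seq int).
Hypothesis cert : jac_cert n.+1 es p q al S B1 B2 c1 c2.
Let G := list_graph es_lt.

(** By linearity it suffices to take [f] a single vertex, which is the first clause of the
    certificate. *)
Lemma coord_laplacian (f : divisor G) : coord p q al (laplacian G *m f) = 0.
Proof.
rewrite (divisor_sum_point f) mulmx_sumr raddf_sum big1 // => v _.
have -> : laplacian G *m (point v *~ f v 0) = (laplacian G *m point v) *~ f v 0.
  exact: (raddfMz (mulmx (laplacian G))).
have -> : point v = col_seq n.+1 (mkseq (fun i => (i == v)%:R) n.+1).
  by apply/matrixP => i j; rewrite ord1 !mxE nth_mkseq // eqxx andbT.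
rewrite raddfMz laplacian_list_graph /= coord_col_seq.
have /and5P[/allP/(_ v) /[!mem_iota] /(_ (ltn_ord v))/eqP-> _ _ _ _] := cert.
by rewrite mul0rz.
Qed.

(** [B1] and [B2] have degree 0 and map to the standard generators. *)
Lemma coord_onto (x : 'I_p.+1 * 'I_q.+1) :
  exists2 D : divisor G, deg D = 0 & coord p q al D = x.
Proof.
have /and5P[_ _ _ _ /and4P[/eqP B1E /eqP B2E /eqP degB1 /eqP degB2]] := cert.
exists (col_seq n.+1 B1 *+ x.1 + col_seq n.+1 B2 *+ x.2).
  have deg_col B : deg (col_seq n.+1 B : divisor G) = sum_seq n.+1 (nth 0 B).
    by rewrite -sum_seqE; apply: eq_bigr => v _; rewrite mxE.
  by rewrite degD !degMn !deg_col degB1 degB2 !mul0rn addr0.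
rewrite raddfD !raddfMn /= !coord_col_seq B1E B2E.
have inZpMn r a m : (inZp a : 'I_r.+1) *+ m = inZp (a * m).
  by apply: val_inj; rewrite Zp_mulrn /= modnMml.
have inZp0 r : inZp 0 = 0 :> 'I_r.+1 by apply: val_inj; rewrite /= mod0n.
case: x => x y.
apply: injective_projections; rewrite [LHS]raddfD /= !raddfMn /=.
  by rewrite !inZpMn mul1n mul0n inZp0 addr0 valZpK.
by rewrite !inZpMn mul1n mul0n inZp0 add0r valZpK.
Qed.

(** For the converse, let [t] send the generators to the classes of [B1] and [B2]. The certificate
    gives [v] = [v_0] + t(coord v), hence [D] = deg D [v_0] + t(coord D), and the first term
    vanishes in degree 0. *)
Lemma coord_principal (D : divisor G) : deg D = 0 ->
  (D \in @principal G) = (coord p q al D == 0).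
Proof.
move=> degD0; apply/idP/eqP => [/principalP[f ->]|coordD].
  exact: coord_laplacian.
have /and5P[_ /allP certS /eqP certc1 /eqP certc2 _] := cert.
have torsion c B m : lap_seq n.+1 es c = mkseq (fun i => B`_i *+ m) n.+1 ->
    \pi_(Pic G) (col_seq n.+1 B) *+ m = 0.
  move=> cE; rewrite -raddfMn -(pi_laplacian (col_seq n.+1 c : divisor G)).
  rewrite laplacian_list_graph cE; congr \pi_(Pic G).
  by apply/matrixP => i j; rewrite mulmxnE !mxE nth_mkseq.
pose t := zp_lift_additive (torsion _ _ _ certc1) (torsion _ _ _ certc2).
suff piD : \pi_(Pic G) D = t (coord p q al D).
  have /lin_equivP : \pi_(Pic G) D = \pi_(Pic G) 0.
    by rewrite piD coordD !raddf0.
  by rewrite /lin_equiv subr0.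
pose v0 : 'I_(order G) := @ord0 n.
have pi_point v : \pi_(Pic G) (point v) =
    \pi_(Pic G) (point v0) + t (zp p q (nth (0, 0)%N al v)).
  rewrite [t _](zp_lift_zp (torsion _ _ _ certc1) (torsion _ _ _ certc2)).
  have /certS/eqP Sv : val v \in iota 0 n.+1.
    by rewrite mem_iota; exact: (ltn_ord v).
  rewrite -!raddfMn -!raddfD; apply/lin_equivP; apply/principalP.
  exists (col_seq n.+1 (nth [::] S v)); rewrite laplacian_list_graph Sv.
  apply/matrixP => i j; rewrite ord1 !mxE nth_mkseq // !mulmxnE !mxE !andbT.
  by rewrite !opprD !addrA.
have -> : \pi_(Pic G) D = \sum_v \pi_(Pic G) (point v) *~ D v 0.
  rewrite {1}[D]divisor_sum_point raddf_sum.
  by apply: eq_bigr => v _; apply: raddfMz.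
rewrite raddf_sum (eq_bigr (fun v => \pi_(Pic G) (point v0) *~ D v 0 +
    t (zp p q (nth (0, 0)%N al v) *~ D v 0))) => [|v _].
  by rewrite big_split /= -mulrz_sumr [\sum_v _]degD0 mulr0z add0r.
by rewrite pi_point mulrzDl raddfMz.
Qed.

Lemma jac_cert_chart : is_chart (coord p q al : {additive divisor G -> _}).
Proof. by split; [|exact: coord_principal|exact: coord_onto]. Qed.

End Cert.

(** * Tables of ranks *)

(** When all values equal a positive constant, the positivity test succeeds and the minimum is that
    constant, so each step adds 1. *)
Lemma hfun_const (J : zmodType) (l : seq J) d c :
    (0 < size l)%N -> (forall x, hfun l d x = c.+1) ->
  forall e x, hfun l (d + e) x = (c + e).+1.
Proof.
move=> l_gt0 lc; elim=> [x|e IHe x]; first by rewrite !addn0.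
have lt_hfun k : (k < hfun l (d + e.+1) x)%N = (k < (c + e.+1).+1)%N.
  rewrite addnS [hfun _ _ _]/= ltn_hstep addnS ltnS.
  case: l l_gt0 IHe {lc} => //= a l _ IHe; rewrite !IHe /=.
  case: leqP => //= k_le; by apply/allP => b _; rewrite IHe.
by apply/eqP; rewrite eqn_leq leqNgt lt_hfun ltnn leqNgt -lt_hfun ltnn.
Qed.

Section Table.
Variables (p q : nat).
Notation J := ('I_p.+1 * 'I_q.+1)%type.

(** Lexicographic order, the second [inZp] reducing [k] modulo q + 1; [code] recovers the index. *)
Definition elems : seq J :=
  [seq (inZp (k %/ q.+1), inZp k) | k <- iota 0 (p.+1 * q.+1)].

Definition code (x : J) : nat := x.1 * q.+1 + x.2.

Lemma code_elem k : (k < p.+1 * q.+1)%N ->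
  code (inZp (k %/ q.+1), inZp k) = k.
Proof.
by move=> k_lt; rewrite /code /= modn_small ?ltn_divLR // -divn_eq.
Qed.

Lemma elem_code x : (inZp (code x %/ q.+1), inZp (code x)) = x.
Proof.
case: x => x y; rewrite /code /= divnMDl // divn_small // addn0 valZpK.
by congr (_, _); apply: val_inj; rewrite /= modnMDl modn_small.
Qed.

Lemma code_lt x : (code x < p.+1 * q.+1)%N.
Proof.
case: x => x y; rewrite /code /=; apply: (@leq_trans (x.+1 * q.+1)).
  by rewrite mulSn addnC ltn_add2r.
by rewrite leq_mul2r ltn_ord orbT.
Qed.

Lemma map_code_elems : map code elems = iota 0 (p.+1 * q.+1).
Proof.
rewrite -map_comp -[RHS]map_id; apply/eq_in_map => k.
by rewrite mem_iota add0n => /code_elem.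
Qed.

Lemma elems_uniq : uniq elems.
Proof. by apply: (@map_uniq _ _ code); rewrite map_code_elems iota_uniq. Qed.

Lemma mem_elems : elems =i predT.
Proof.
move=> x; apply/mapP; exists (code x); rewrite ?elem_code //.
by rewrite mem_iota code_lt.
Qed.

Lemma size_elems : size elems = (p.+1 * q.+1)%N.
Proof. by rewrite size_map size_iota. Qed.

(** The previous table is computed once and looked up, whereas unfolding [hfun] branches over all of
    [l] at every degree. *)
Fixpoint htable (l : seq J) (d : nat) : seq nat :=
  if d is d'.+1 then
    let t := htable l d' in
    [seq hstep l (fun x => nth 0%N t (code x)) x | x <- elems]
  else [seq (x == 0 : nat) | x <- elems].

Lemma htableE l d : htable l d = [seq hfun l d x | x <- elems].
Proof.
elim: d => // d IHd; transitivity
  [seq hstep l (fun x => nth 0%N (htable l d) (code x)) x | x <- elems] => //.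
rewrite {}IHd; apply: eq_map => x.
have /funext -> // :
  (fun x => nth 0%N [seq hfun l d x | x <- elems] (code x)) =1 hfun l d.
move=> y; rewrite (nth_map 0) ?size_elems ?code_lt //.
by rewrite (nth_map 0%N) ?size_iota ?code_lt // nth_iota ?code_lt // elem_code.
Qed.

Lemma zp_exponent m :
  (p.+1 %| m)%N -> (q.+1 %| m)%N -> forall x : J, x *+ m = 0.
Proof.
move=> pm qm [x y]; apply: injective_projections; rewrite raddfMn /= Zp_mulrn;
  by apply: val_inj; apply/eqP; rewrite /= -/(dvdn _ _) dvdn_mull.
Qed.
End Table.

Lemma map_coord_point p q (G : graph) al : size al = order G ->
  [seq coord p q al (point v) | v <- enum 'I_(order G)] =
  [seq zp p q a | a <- al].
Proof.
move=> sz_al; apply: (@eq_from_nth _ 0).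
  by rewrite [LHS]size_map [RHS]size_map size_enum_ord.
move=> i; rewrite size_map size_enum_ord => i_lt.
rewrite (nth_map (Ordinal i_lt)) ?size_enum_ord // coord_point nth_enum_ord //.
by rewrite (nth_map (0, 0)%N) ?sz_al.
Qed.

(** A coefficient of the zeta function depends only on the multiset of table values. Sorted tables
    are compared below [d0]; from [d0] on both are constant, of the same length and value. *)
Lemma zeta_eq_tables (G G' : graph) p q al p' q' al' d0 h :
    is_chart (coord p q al : {additive divisor G -> _}) ->
    is_chart (coord p' q' al' : {additive divisor G' -> _}) ->
    size al = order G -> size al' = order G' ->
    let l := [seq zp p q a | a <- al] in
    let l' := [seq zp p' q' a | a <- al'] in
    all (fun d => sort leq (htable l d) == sort leq (htable l' d))
      (iota 0 d0) ->
    htable l d0 = nseq (p.+1 * q.+1) h.+1 ->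
    htable l' d0 = nseq (p.+1 * q.+1) h.+1 ->
  zeta G =1 zeta G'.
Proof.
move=> ch ch' sz_al sz_al' l l' /allP perm_l lE l'E d.
have [G_gt0 _ _] := ch; have [G'_gt0 _ _] := ch'.
rewrite (zeta_hfun ch d (@elems_uniq p q) (@mem_elems p q)).
rewrite (zeta_hfun ch' d (@elems_uniq p' q') (@mem_elems p' q')).
rewrite !map_coord_point // -/l -/l'; case: d => m; last first.
  by rewrite !big1 // => x _; rewrite zeta_summandE big_ord0.
rewrite -(big_map _ xpredT zeta_summand) -[RHS](big_map _ xpredT zeta_summand).
rewrite -!htableE; apply: perm_big; case: (ltnP m d0) => [m_lt|].
  by apply/(@perm_of_sort _ leq)/eqP/perm_l; rewrite mem_iota.
have const p1 q1 al1 k d : (0 < size al1)%N ->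
    htable [seq zp p1 q1 a | a <- al1] d0 = nseq k h.+1 ->
    htable [seq zp p1 q1 a | a <- al1] (d0 + d) = nseq k (h + d).+1.
  move=> al1_gt0 tE; have k_elems : k = size (elems p1 q1).
    by have := congr1 size tE; rewrite htableE size_map size_nseq.
  rewrite htableE k_elems.
  rewrite -(size_map (hfun [seq zp p1 q1 a | a <- al1] (d0 + d))).
  apply/all_pred1P/allP => _ /mapP[x _ ->] /=.
  rewrite (hfun_const (c := h)) ?size_map // => y.
  have : hfun [seq zp p1 q1 a | a <- al1] d0 y \in nseq k h.+1.
    by rewrite -tE htableE map_f // mem_elems.
  by rewrite mem_nseq => /andP[_ /eqP].
by move=> /subnKC<-; rewrite !(const _ _ _ (p.+1 * q.+1)%N) ?sz_al ?sz_al'.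
Qed.

(** * Two graphs with eight vertices and eleven edges *)

Definition es_cyc : seq (nat * nat) :=
  [:: (0, 1); (0, 4); (1, 6); (2, 5); (2, 7); (3, 6); (3, 7); (4, 5); (4, 7);
      (5, 6); (6, 7)]%N.

Definition es_noncyc : seq (nat * nat) :=
  [:: (0, 1); (0, 6); (1, 7); (2, 4); (2, 6); (3, 4); (3, 7); (4, 5); (5, 6);
      (5, 7); (6, 7)]%N.

Lemma es_cyc_lt : lt_edges 8 es_cyc. Proof. by []. Qed.
Lemma es_noncyc_lt : lt_edges 8 es_noncyc. Proof. by []. Qed.

Definition G_cyc := list_graph es_cyc_lt.
Definition G_noncyc := list_graph es_noncyc_lt.

Lemma tutte_eq : tutte G_cyc = tutte G_noncyc.
Proof.
have cyc_uniq : uniq es_cyc by vm_compute.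
have noncyc_uniq : uniq es_noncyc by vm_compute.
have rankE : rank_labels 8 es_cyc = rank_labels 8 es_noncyc by vm_compute.
have sizesE : perm_eq (rank_sizes 8 es_cyc) (rank_sizes 8 es_noncyc).
  (* Sizes are at most 11, so base 12 encodes the pairs injectively and equal multisets sort to
     equal lists. *)
  apply: (@perm_of_sort _ (fun x y => x.1 * 12 + x.2 <= y.1 * 12 + y.2)%N).
  by vm_compute.
exact: (tutte_list_graph_eq es_cyc_lt es_noncyc_lt cyc_uniq noncyc_uniq rankE
  sizesE).
Qed.

(** Entry i is the class of v_i - v_0 in Z/1 x Z/125, the first factor being trivial. *)
Definition coords_cyc : seq (nat * nat) :=
  [:: (0, 0); (0, 1); (0, 61); (0, 10); (0, 124); (0, 104); (0, 2); (0, 18)]%N.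

Definition coords_noncyc : seq (nat * nat) :=
  [:: (0, 0); (0, 1); (1, 11); (1, 0); (2, 23); (4, 8); (0, 24); (0, 2)]%N.

(** The generator is v_1 - v_0, and [c2] has Laplacian 125 (v_1 - v_0). *)
Lemma chart_cyc :
  is_chart (coord 0 124 coords_cyc : {additive divisor G_cyc -> _}).
Proof.
apply: (jac_cert_chart es_cyc_lt
  (S := [:: [::]; [::]; [:: 22; -23; 0; -4; 7; 0; -7; -1];
    [:: 3; -4; 0; 0; 1; 0; -1]; [:: 47; -45; 0; -7; 16; 1; -13; -1];
    [:: 39; -38; 0; -6; 13; 1; -11; -1]; [:: 0; -1];
    [:: 6; -7; 0; -1; 2; 0; -2]])
  (B1 := [::]) (B2 := [:: -1; 1])
  (c1 := [::]) (c2 := [:: 0; 93; 48; 55; 32; 47; 61; 49])).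
by vm_compute.
Qed.

(** The generators of Z/5 and Z/25 are v_3 - v_0 and v_1 - v_0; [c1] and [c2] have Laplacians 5 (v_3
    - v_0) and 25 (v_1 - v_0). *)
Lemma chart_noncyc :
  is_chart (coord 4 24 coords_noncyc : {additive divisor G_noncyc -> _}).
Proof.
apply: (jac_cert_chart es_noncyc_lt
  (S := [:: [::]; [::]; [:: 4; -4; 1; -1; 0; 0; 1; -1]; [::];
    [:: 9; -8; 1; -2; 0; 0; 2; -2]; [:: 5; -2; 0; -3; -1; 0; 1; -1];
    [:: 8; -9; 1; -1; 0; 0; 2; -2]; [:: 0; -1]])
  (B1 := [:: -1; 0; 0; 1]) (B2 := [:: -1; 1])
  (c1 := [:: 0; 2; 4; 7; 5; 4; 3; 4])
  (c2 := [:: 0; 18; 8; 10; 9; 9; 7; 11])).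
by vm_compute.
Qed.

Lemma zeta_eq : zeta G_cyc =1 zeta G_noncyc.
Proof.
(* The genus is 11 - 8 + 1 = 4, so degree 7 is the first above 2 * 4 - 2; there h(D) = 7 - 4 + 1 =
   4, which is [h.+1]. *)
apply: (zeta_eq_tables (d0 := 7) (h := 3) chart_cyc chart_noncyc erefl erefl).
- by vm_compute.
- by vm_compute.
- by vm_compute.
Qed.

Lemma group_iso_exponent (A B : zmodType) m : group_iso A B ->
  (forall y : B, y *+ m = 0) -> forall x : A, x *+ m = 0.
Proof.
by case=> f [g fK _] B0 x; apply: (can_inj fK); rewrite raddfMn raddf0 B0.
Qed.

Lemma jac_not_iso : ~ group_iso (Jac G_cyc) (Jac G_noncyc).
Proof.
move=> /group_iso_exponent iso25.
have noncyc25 := @zp_exponent 4 24 25 isT isT.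
have cyc25 := iso25 25%N (iffRL (jac_exponent chart_noncyc 25) noncyc25).
(* The generator of Z/125 would be killed by 25. *)
have := iffLR (jac_exponent chart_cyc 25) cyc25 (zp 0 124 (0, 1)%N).
by move=> /(congr1 snd); rewrite raddfMn /= Zp_mulrn => /(congr1 val).
Qed.

Theorem theorem1p2 :
  exists G G' : graph,
    [/\ connected G, connected G',
        tutte G = tutte G',
        zeta G =1 zeta G' &
        ~ group_iso (Jac G) (Jac G')].
Proof.
exists G_cyc, G_noncyc; split.
(* Merging keeps the label of the larger endpoint, and all eight labels end as 7. *)
- by apply: (connected_list_graph es_cyc_lt (c := 7)); vm_compute.
- by apply: (connected_list_graph es_noncyc_lt (c := 7)); vm_compute.
- exact: tutte_eq.
- exact: zeta_eq.
- exact: jac_not_iso.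
Qed.
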